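(* Let $r\ge1$, let $P_r=\Phi^+(B_r)$ be the positive-root poset of type $B_r$ graded by $\operatorname{rk}(\alpha)=\operatorname{ht}(\alpha)-1$, and put $n=r-1$. For $0\le k\le n$, $$[t^k]\,\mathbb{H}_{P_r,\operatorname{rk}}(q,t)\in q^{k(k-1)}\,\mathbb{N}[q],\qquad \deg_q\,[t^k]\,\mathbb{H}_{P_r,\operatorname{rk}}(q,t)=k(2n-k-1).$$ Moreover, the coefficient of the highest power $q^{k(2n-k-1)}$ in $[t^k]\,\mathbb{H}_{P_r,\operatorname{rk}}(q,t)$ is equal to $1$.
   Context: $\mathbb N=\{0,1,2,\dots\}$. $q$-Zeta numerator: let $P$ be a finite graded poset with a unique maximum and rank function $\rho:P\to\{0,\dots,H\}$, where $H$ is the maximal rank. For $m\ge 0$ put $A_m(P,\rho;q)=\sum_{x_1\le\cdots\le x_m}q^{\rho(x_1)+\cdots+\rho(x_m)}$ (sum over weak chains in $P$; $A_0=1$). The numerator $\mathbb{H}_{P,\rho}(q,t)$ is the polynomial determined by $\sum_{m\ge 0}A_m(P,\rho;q)t^m=\mathbb{H}_{P,\rho}(q,t)/\prod_{a=0}^{H}(1-q^at)$. Type $B_r$ in $\mathbb{R}^r$ with standard basis $e_1,\dots,e_r$: simple roots $\alpha_i=e_i-e_{i+1}$ ($1\le i<r$), $\alpha_r=e_r$; positive roots $e_i-e_j$ ($i<j$), $e_i$, $e_i+e_j$ ($i<j$). Order: $\alpha\le\beta$ iff $\beta-\alpha$ is a nonnegative integer combination of simple roots. The height $\operatorname{ht}(\alpha)$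 is the sum of the simple-root coefficients of $\alpha$. *)

(* Defs.v *)
From HB Require Import structures.
From mathcomp Require Import all_boot all_order all_algebra.

Set Implicit Arguments.
Unset Strict Implicit.
Unset Printing Implicit Defensive.

Import Order.TTheory GRing.Theory Num.Theory.
Local Open Scope ring_scope.

(* In {poly {poly int}} the inner variable is q and the outer one is t, so     *)
(* N`_k is the coefficient [t^k] N, and q^a t is 'X^a *: 'X. A power series in *)
(* t over Z[q] is a sequence of coefficients nat -> {poly int}.                *)

Definition series_mul (p : {poly {poly int}}) (a : nat -> {poly int}) (m : nat) :
  {poly int} := \sum_(j < m.+1) p`_j * a (m - j)%N.

Section QZeta.

Variables (d : Order.disp_t) (P : finPOrderType d) (rho : P -> nat).

Definition qzeta (m : nat) : {poly int} :=
  \sum_(s : m.-tuple P | sorted <=%O s) 'X^(\sum_(x <- s) rho x).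

Definition max_rank : nat := \max_(x : P) rho x.

Definition qzeta_denom : {poly {poly int}} :=
  \prod_(a < max_rank.+1) (1 - 'X^a *: 'X).

(* The truncation at t-degree max_rank + 1 loses nothing when rho is strictly  *)
(* increasing, as for the rank function of a graded poset: the defining        *)
(* property is qzeta_numeratorP below.                                         *)
Definition qzeta_numerator : {poly {poly int}} :=
  \poly_(k < max_rank.+2) series_mul qzeta_denom qzeta k.

End QZeta.

Section TypeB.

Variable r : nat.

Definition stdvec (i : 'I_r) : 'rV[int]_r := delta_mx 0 i.

Definition simple_root (i : 'I_r) : 'rV[int]_r :=
  if insub i.+1 is Some j then stdvec i - stdvec j else stdvec i.

Definition simple_mx : 'M[int]_r := \matrix_i simple_root i.

Definition simple_coords (v : 'rV[int]_r) : 'rV[int]_r := v *m invmx simple_mx.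

Definition height (v : 'rV[int]_r) : int := \sum_i simple_coords v 0 i.

Definition pos_roots : seq 'rV[int]_r :=
  [seq stdvec i - stdvec j | i <- enum 'I_r, j <- enum [pred j : 'I_r | (i < j)%N]]
  ++ [seq stdvec i | i <- enum 'I_r]
  ++ [seq stdvec i + stdvec j | i <- enum 'I_r, j <- enum [pred j : 'I_r | (i < j)%N]].

Definition pos_root : Type := seq_sub pos_roots.

HB.instance Definition _ := Finite.on pos_root.

Definition root_le (x y : pos_root) : bool :=
  [forall i, 0 <= simple_coords (val y - val x) 0 i].

(* The height of a positive root is at least 1 (height_pos_root), so the       *)
(* absolute value only serves as a cast from int to nat; see rkE.              *)
Definition rk (x : pos_root) : nat := absz (height (val x) - 1)%R.

Definition simple_coords_mx : 'M[int]_r := \matrix_(j, i) (j <= i)%N%:R.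

Lemma simple_mxE i k :
  simple_mx i k = (k == i)%:R - ((k : nat) == i.+1)%:R.
Proof.
rewrite mxE /simple_root; case: insubP => [j lt_i ej|].
  by rewrite !mxE !eqxx /= -ej.
rewrite -leqNgt => le_r; rewrite !mxE eqxx /=.
suff /negbTE-> : (k : nat) != i.+1 by rewrite subr0.
by rewrite neq_ltn (leq_trans (ltn_ord k) le_r).
Qed.

Lemma simple_coords_mxK : simple_coords_mx *m simple_mx = 1%:M.
Proof.
apply/matrixP=> j k; rewrite !mxE.
under eq_bigr => i _ do rewrite simple_mxE mxE mulrBr.
rewrite sumrB (bigD1 k) //= eqxx mulr1 big1 ?addr0; last first.
  by move=> i ne; rewrite eq_sym (negbTE ne) mulr0.
have [k0|k_gt0] := posnP k.
  rewrite big1 => [|i _]; last by rewrite k0 mulr0.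
  by rewrite subr0 k0 leqn0 -k0.
have lt_k : (k.-1 < r)%N by apply: leq_ltn_trans (leq_pred _) (ltn_ord k).
rewrite (bigD1 (Ordinal lt_k)) //= prednK // eqxx mulr1 big1 => [|i ne].
  rewrite addr0 -(inj_eq val_inj) /=; case: (ltngtP j k) => jk.
  - by rewrite -ltnS prednK // jk subrr.
  - by rewrite -ltnS prednK // ltnNge ltnW //= subr0.
  - by rewrite -ltnS prednK // jk ltnn subr0.
case: eqP => [e|]; last by rewrite mulr0.
by case/negP: ne; rewrite -(inj_eq val_inj) /= e.
Qed.

Lemma simple_mx_unit : simple_mx \in unitmx.
Proof. by case: (mulmx1_unit simple_coords_mxK). Qed.

Lemma invmx_simple : invmx simple_mx = simple_coords_mx.
Proof.
by rewrite -[LHS]mul1mx -simple_coords_mxK mulmxK // simple_mx_unit.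
Qed.

Lemma simple_coordsK v : \sum_i simple_coords v 0 i *: simple_root i = v.
Proof.
rewrite -[RHS](mulmxKV simple_mx_unit) mulmx_sum_row.
by apply: eq_bigr => i _; rewrite rowK.
Qed.

Lemma simple_coords_sum (c : 'rV[int]_r) :
  simple_coords (\sum_i c 0 i *: simple_root i) = c.
Proof.
have -> : \sum_i c 0 i *: simple_root i = c *m simple_mx.
  by rewrite mulmx_sum_row; apply: eq_bigr => i _; rewrite rowK.
exact: (mulmxK simple_mx_unit).
Qed.

Lemma root_leP x y :
  reflect (exists c : 'I_r -> nat,
             val y - val x = \sum_i (c i)%:Z *: simple_root i)
          (root_le x y).
Proof.
apply: (iffP forallP) => [ge0|[c ->] i].
  exists (fun i => absz (simple_coords (val y - val x) 0%R i)).
  rewrite -[LHS]simple_coordsK; apply: eq_bigr => i _.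
  by rewrite gez0_abs.
have -> : \sum_i (c i)%:Z *: simple_root i
  = \sum_i (\row_j (c j)%:Z) 0 i *: simple_root i.
  by apply: eq_bigr => j _; rewrite mxE.
by rewrite simple_coords_sum mxE.
Qed.

Lemma root_le_refl : reflexive root_le.
Proof.
by move=> x; apply/forallP=> i; rewrite subrr /simple_coords mul0mx mxE.
Qed.

Lemma root_le_anti : antisymmetric root_le.
Proof.
move=> x y /andP[/forallP xy /forallP yx]; apply: val_inj.
apply/eqP; rewrite -subr_eq0; apply/eqP.
rewrite -[LHS]simple_coordsK big1 // => i _.
suff -> : simple_coords (val x - val y) 0 i = 0 by rewrite scale0r.
apply/eqP; rewrite eq_le yx andbT -oppr_ge0.
suff -> : - simple_coords (val x - val y) 0 i = simple_coords (val y - val x) 0 i.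
  exact: xy.
by rewrite -[val y - val x]opprB /simple_coords mulNmx [RHS]mxE.
Qed.

Lemma root_le_trans : transitive root_le.
Proof.
move=> y x z /forallP xy /forallP yz; apply/forallP=> i.
rewrite -(subrKA (val y)) /simple_coords mulmxDl mxE.
by apply: addr_ge0; [apply: yz | apply: xy].
Qed.

HB.instance Definition _ := Order.Le_isPOrder.Build
  (Order.Disp tt tt) pos_root root_le_refl root_le_anti root_le_trans.

Lemma root_leE (x y : pos_root) : (x <= y)%O = root_le x y.
Proof. by []. Qed.

Lemma mem_pos_root (x : pos_root) : val x \in pos_roots.
Proof. exact: valP. Qed.

Lemma simple_coordsE (v : 'rV[int]_r) i :
  simple_coords v 0 i = \sum_(j < r | (j <= i)%N) v 0 j.
Proof.
rewrite /simple_coords invmx_simple mxE [RHS]big_mkcond; apply: eq_bigr => j _.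
by rewrite mxE; case: leqP => _; rewrite ?mulr1 ?mulr0.
Qed.

Lemma simple_coords_std j i : simple_coords (stdvec j) 0 i = (j <= i)%N%:R.
Proof. by rewrite /simple_coords invmx_simple -rowE !mxE. Qed.

Lemma heightB v w : height (v - w) = height v - height w.
Proof.
rewrite /height -sumrB; apply: eq_bigr => i _.
by rewrite /simple_coords mulmxBl !mxE.
Qed.

Lemma height_ge v i : (forall j, 0 <= simple_coords v 0 j) ->
  simple_coords v 0 i <= height v.
Proof. by move=> v_ge0; rewrite /height (bigD1 i) //= lerDl sumr_ge0. Qed.

Lemma height_pos_root (x : pos_root) : 1 <= height (val x).
Proof.
suff [i ge0 ge1] : exists2 i, forall j, 0 <= simple_coords (val x) 0 j
    & 1 <= simple_coords (val x) 0 i.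
  exact: le_trans ge1 (height_ge _ ge0).
case: x => v /=; rewrite !mem_cat => /or3P[/allpairsPdep|/mapP|/allpairsPdep].
- case=> i [j] [_]; rewrite mem_enum inE => lt_ij ->.
  have cE l : simple_coords (stdvec i - stdvec j) 0 l
      = (i <= l)%N%:R - (j <= l)%N%:R.
    by rewrite -!simple_coords_std /simple_coords mulmxBl !mxE.
  exists i => [l|]; rewrite cE ?leqnn.
    rewrite subr_ge0; case: (leqP j l) => // jl.
    by rewrite (leq_trans (ltnW lt_ij) jl).
  by rewrite leqNgt lt_ij.
- by case=> i _ ->; exists i => [l|]; rewrite simple_coords_std ?leqnn.
- case=> i [j] [_ _ ->].
  have cE l : simple_coords (stdvec i + stdvec j) 0 l
      = (i <= l)%N%:R + (j <= l)%N%:R.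
    by rewrite -!simple_coords_std /simple_coords mulmxDl !mxE.
  by exists i => [l|]; rewrite cE ?leqnn ?lerDl ?addr_ge0.
Qed.

Lemma rkE x : (rk x)%:Z = height (val x) - 1.
Proof. by rewrite /rk gez0_abs // subr_ge0 height_pos_root. Qed.

Lemma rk_lt (x y : pos_root) : (x < y)%O -> (rk x < rk y)%N.
Proof.
rewrite lt_neqAle => /andP[ne /forallP ge0].
rewrite -ltz_nat !rkE ltrD2r -subr_gt0 -heightB.
rewrite lt_def sumr_ge0 // andbT; apply: contraNneq ne => ht0.
apply/eqP/val_inj/esym/eqP; rewrite -subr_eq0; apply/eqP.
rewrite -[LHS]simple_coordsK big1 // => i _.
suff -> : simple_coords (val y - val x) 0 i = 0 by rewrite scale0r.
by apply/eqP; rewrite eq_le ge0 andbT -ht0 height_ge.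
Qed.

End TypeB.

Section SeriesMul.

Implicit Types (p q : {poly {poly int}}) (a : nat -> {poly int}).

Lemma series_mulE p a M m : (m < M)%N ->
  series_mul p a m = (p * \poly_(i < M) a i)`_m.
Proof.
move=> ltmM; rewrite coefM; apply: eq_bigr => j _.
by rewrite coef_poly (leq_ltn_trans (leq_subr _ _) ltmM).
Qed.

Lemma eq_series_mul p a b : a =1 b -> series_mul p a =1 series_mul p b.
Proof. by move=> eq_ab m; apply: eq_bigr => j _; rewrite eq_ab. Qed.

Lemma series_mulM p q a m :
  series_mul (p * q) a m = series_mul p (series_mul q a) m.
Proof.
rewrite (series_mulE _ _ (ltnSn m)) -mulrA coefM; apply: eq_bigr => j _.
by rewrite -series_mulE // ltnS leq_subr.
Qed.

Lemma series_mul_vanish p a dp da m :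
  (size p <= dp.+1)%N -> (forall i, (da < i)%N -> a i = 0) ->
  (dp + da < m)%N -> series_mul p a m = 0.
Proof.
move=> szp a0 ltm; rewrite /series_mul big1 // => j _.
have [le_jd | lt_dj] := leqP j dp.
  by rewrite a0 ?mulr0 // ltn_subRL (leq_ltn_trans _ ltm) // leq_add2r.
by rewrite nth_default ?mul0r // (leq_trans szp).
Qed.

Lemma series_mul_rec (I : finType) (Q : pred I) (c : I -> {poly int})
    (b : I -> nat -> {poly int}) p a :
  a 0%N = 1 -> (forall m, a m.+1 = \sum_(y | Q y) c y * b y m) ->
  forall m, series_mul p a m.+1
    = p`_m.+1 + \sum_(y | Q y) c y * series_mul p (b y) m.
Proof.
move=> a0 aS m; rewrite /series_mul big_ord_recr /= subnn a0 mulr1 addrC.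
congr (_ + _); under [RHS]eq_bigr do rewrite mulr_sumr.
rewrite exchange_big /=; apply: eq_bigr => j _.
rewrite (subSn (leq_ord j)) aS mulr_sumr; apply: eq_bigr => y _.
by rewrite mulrCA.
Qed.

End SeriesMul.

Section QZetaTheory.

Variables (d : Order.disp_t) (P : finPOrderType d) (rho : P -> nat).
Hypothesis rho_lt : forall x y : P, (x < y)%O -> (rho x < rho y)%N.

Local Notation H := (max_rank rho).

Let chains (x : P) (m : nat) : {poly int} :=
  \sum_(s : m.-tuple P | path <=%O x s) 'X^(\sum_(x <- s) rho x).

Let big_tuple_cons m (Q : pred (seq P)) (F : seq P -> {poly int}) :
  \sum_(s : m.+1.-tuple P | Q s) F s
  = \sum_(y : P) \sum_(s : m.-tuple P | Q (y :: s)) F (y :: s).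
Proof.
rewrite pair_big_dep /=.
rewrite (reindex (fun u : P * m.-tuple P => [tuple of u.1 :: u.2])) //=.
exists (fun s : m.+1.-tuple P => (thead s, [tuple of behead s])).
  by move=> [y s] _ /=; congr pair; apply: val_inj.
by move=> s _; rewrite /= -tuple_eta.
Qed.

Let chains0 x : chains x 0 = 1.
Proof.
rewrite /chains (big_pred1 [tuple]) => [|s]; first by rewrite big_nil.
by rewrite tuple0 /= eqxx.
Qed.

Let qzeta0 : qzeta rho 0 = 1.
Proof.
rewrite /qzeta (big_pred1 [tuple]) => [|s]; first by rewrite big_nil.
by rewrite tuple0 /= eqxx.
Qed.

Let qzetaS m : qzeta rho m.+1 = \sum_(y | true) 'X^(rho y) * chains y m.
Proof.
rewrite /qzeta (big_tuple_cons _ (sorted <=%O)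
  (fun s => 'X^(\sum_(x <- s) rho x))) /=.
apply: eq_bigr => y _; rewrite /chains mulr_sumr; apply: eq_bigr => s _.
by rewrite big_cons exprD.
Qed.

Let chainsS x m :
  chains x m.+1 = \sum_(y | (x <= y)%O) 'X^(rho y) * chains y m.
Proof.
rewrite /chains (big_tuple_cons _ (path <=%O x)
  (fun s => 'X^(\sum_(x <- s) rho x))) /= [RHS]big_mkcond /=.
apply: eq_bigr => y _; case: ifP => _ /=; last by rewrite big_pred0.
by rewrite mulr_sumr; apply: eq_bigr => s _; rewrite big_cons exprD.
Qed.

Let fac (a : nat) : {poly {poly int}} := 1 - 'X^a *: 'X.

Let facs i j := \prod_(i <= a < j) fac a.

Let size_facs i j : (size (facs i j) <= (j - i).+1)%N.
Proof.
rewrite /facs; elim: j => [|j IH]; first by rewrite big_geq // size_poly1.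
have [le_ij | lt_ji] := leqP i j; last by rewrite big_geq // size_poly1.
rewrite big_nat_recr //= subSn // (leq_trans (size_polyMleq _ _)) // -subn1.
have sz : (size (fac j) <= 2)%N.
  rewrite (leq_trans (size_polyD _ _)) // geq_max size_poly1 size_polyN.
  by rewrite (leq_trans (size_scale_leq _ _)) // size_polyX.
by rewrite (leq_trans (leq_sub2r 1 (leq_add IH sz))) // addn2 subn1.
Qed.

Let denomE : qzeta_denom rho = facs 0 H.+1.
Proof. by rewrite /facs big_mkord. Qed.

Let facs_cat i j k : (i <= j)%N -> (j <= k)%N ->
  facs i k = facs i j * facs j k.
Proof. by move=> ij jk; rewrite /facs -big_cat_nat. Qed.

Let rho_le x : (rho x <= H)%N.
Proof. by rewrite /max_rank (bigD1 x) //= leq_maxl. Qed.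

Let series_mul_fac0 a b : series_mul (fac a) b 0 = b 0%N.
Proof.
by rewrite /series_mul big_ord1 coefB coef1 coefZ coefX mulr0 subr0 mul1r.
Qed.

Let series_mul_facS a b m :
  series_mul (fac a) b m.+1 = b m.+1 - 'X^a * b m.
Proof.
rewrite /series_mul !big_ord_recl big1 ?addr0 => [|i _].
  rewrite !coefB !coef1 !coefZ !coefX /= /bump /= addn0 subn0 subn1 /=.
  by rewrite mulr0 mulr1 subr0 sub0r mul1r mulNr.
by rewrite coefB coef1 coefZ coefX /= mulr0 subr0 mul0r.
Qed.

Let chains_vanish x m : (H - rho x < m)%N ->
  series_mul (facs (rho x) H.+1) (chains x) m = 0.
Proof.
have [n] := ubnP (H - rho x); elim: n => // n IH in x m *.
rewrite ltnS => le_n; case: m => // m lt_m.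
rewrite /facs big_ltn ?ltnS ?rho_le // mulrC -/(facs _ _) series_mulM.
rewrite (@series_mul_rec _ (fun y => x < y)%O (fun y => 'X^(rho y)) chains).
- rewrite nth_default ?add0r; last first.
    by rewrite (leq_trans (size_facs _ _)) // subSS.
  rewrite big1 // => y lt_xy.
  have lt_r := rho_lt lt_xy; have le_H := rho_le y.
  rewrite (@facs_cat _ (rho y)) ?(leq_trans le_H) // series_mulM.
  rewrite (series_mul_vanish (size_facs _ _) (da := (H - rho y)%N)) ?mulr0 //.
    move=> i; apply: IH; apply: leq_trans le_n.
    by rewrite ltn_sub2l // (leq_trans lt_r).
  rewrite addnC addnBA // subnK // -ltnS.
  by rewrite -subSn ?subSS // (leq_trans lt_r).
- by rewrite series_mul_fac0 chains0.
- move=> i; rewrite series_mul_facS chainsS (bigD1 x) //= addrAC subrr add0r.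
  by apply: eq_bigl => y; rewrite lt_neqAle eq_sym andbC.
Qed.

Lemma qzeta_numeratorP m :
  series_mul (qzeta_denom rho) (qzeta rho) m = (qzeta_numerator rho)`_m.
Proof.
rewrite coef_poly; case: ltnP => //; case: m => // m lt_m.
rewrite (series_mul_rec _ qzeta0 qzetaS) denomE nth_default ?add0r; last first.
  by rewrite (leq_trans (size_facs _ _)) // subn0.
rewrite big1 // => y _; have le_H := rho_le y.
rewrite (@facs_cat _ (rho y)) ?(leq_trans le_H) // series_mulM.
rewrite (series_mul_vanish (size_facs _ _) (@chains_vanish y)) ?mulr0 //.
by rewrite subn0 subnKC.
Qed.

Lemma qzeta_numerator_unique (N : {poly {poly int}}) :
  (forall m, series_mul (qzeta_denom rho) (qzeta rho) m = N`_m) ->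
  N = qzeta_numerator rho.
Proof. by move=> NP; apply/polyP=> m; rewrite -NP qzeta_numeratorP. Qed.

End QZetaTheory.

(* Main.v *)
Require Import Defs.
From mathcomp Require Import all_boot all_order all_algebra.
From mathcomp Require Import zify.

(* Sending a positive root to the pair (l, u), where l and u count the         *)
(* remaining steps e_l -> e_(l-1) on the left end and the remaining extensions *)
(* on the right end towards the highest root, identifies P_r with the pairs    *)
(* l <= u, l + u <= h = 2n, ordered by reversed componentwise order, with      *)
(* rank h - l - u.                                                             *)
(* Let U(l,u) be the chain series of the up-set of (l, u) and D(l,v) that of   *)
(* the chains whose minimum is a pair (l, u) with u < v.  Multiplied by the    *)
(* factors 1 - q^a t for the ranks a >= h - l - u, resp. a >= h + 1 - l - v,   *)
(* they become polynomials N(l,u) and E(l,v) with                              *)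
(*   N(l,u)   = N(l-1,u) + E(l,u),                                             *)
(*   E(l,v+1) = E(l,v) + q^(h-l-v) t N(l-1,v),                                 *)
(* and the numerator is the sum of the E(l, h+1-l) over l <= n.  The recursion *)
(* has no signs, and it propagates lower and upper bounds on the q-exponents   *)
(* of [t^k].  The extremal term q^(k(h-k-1)) only enters E(l, -) at v = l = k, *)
(* so it is contributed once, by the summand l = k.                            *)

Set Implicit Arguments.
Unset Strict Implicit.
Unset Printing Implicit Defensive.

Import Order.TTheory GRing.Theory Num.Theory.
Local Open Scope ring_scope.

(** The signs of the denominator cancel locally. For l >= 1 put c = h-l-u. Then U(l,u) = U(l-1,u) +
    D(l,u+1), and splitting off the minimum (l,u) gives D(l,u+1) = D(l,u) + q^c t U(l,u). Hence (1 -
    q^c t) U(l,u) = U(l-1,u) + D(l,u) and (1 - q^c t) D(l,u+1) = D(l,u) + q^c t U(l-1,u); multiplied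
    by the factors of rank above c, these are [upnumS] and [rownumS], and positivity follows. Each
    use of [rownumS] trades one power of t for q^c, and [num_boundsP] weighs this against the two
    extremal exponents. [root_of_bij] and [root_of_le] identify roots with pairs;
    [qzeta_numerator_rk] sums the rows. *)

Section SeriesShift.

Implicit Types (p : {poly {poly int}}) (a b : nat -> {poly int}).

Definition tshift a (m : nat) : {poly int} := if m is m'.+1 then a m' else 0.

Lemma series_mulDM p a (c : {poly int}) b m :
  series_mul p (fun i => a i + c * b i) m
  = series_mul p a m + c * series_mul p b m.
Proof.
rewrite /series_mul mulr_sumr -big_split; apply: eq_bigr => j _ /=.
by rewrite mulrDr mulrCA.
Qed.

Lemma series_mul_tshift p a m :
  series_mul p (tshift a) m = tshift (series_mul p a) m.
Proof.
case: m => [|m]; first by rewrite /series_mul big_ord1 mulr0.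
rewrite /series_mul big_ord_recr /= subnn mulr0 addr0.
by apply: eq_bigr => j _; rewrite subSn ?leq_ord.
Qed.

Lemma series_mul_linear c a m :
  series_mul (1 - 'X^c *: 'X) a m = a m - 'X^c * tshift a m.
Proof.
rewrite /series_mul big_ord_recl subn0 coefB coef1 coefZ coefX mulr0 subr0.
rewrite mul1r; congr (_ + _); case: m => [|m]; first by rewrite big_ord0 mulr0 oppr0.
rewrite big_ord_recl big1 => [|i _]; rewrite coefB coef1 coefZ coefX /=.
  by rewrite subSS subn0 mulr1 sub0r addr0 mulNr.
by rewrite mulr0 subr0 mul0r.
Qed.

Lemma series_mul1 a m : series_mul 1 a m = a m.
Proof.
rewrite /series_mul big_ord_recl coef1 mul1r subn0 big1 ?addr0 // => i _.
by rewrite coef1 mul0r.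
Qed.

End SeriesShift.

Lemma big_tuple_cons (V : nmodType) (A : finType) m (Q : pred (seq A)) (F : seq A -> V) :
  \sum_(s : m.+1.-tuple A | Q s) F s
  = \sum_(y : A) \sum_(s : m.-tuple A | Q (y :: s)) F (y :: s).
Proof.
rewrite pair_big_dep (reindex (fun p : A * m.-tuple A => [tuple of p.1 :: p.2])) //.
exists (fun s : m.+1.-tuple A => (thead s, [tuple of behead s])) => [[y s] _|s _].
  by congr pair; apply: val_inj.
by rewrite -tuple_eta.
Qed.

(** * Polynomials in q with natural coefficients and a lower bound on the exponents *)

Definition nat_dvdXn (e : nat) (p : {poly int}) : Prop :=
  forall i, 0 <= p`_i /\ ((i < e)%N -> p`_i = 0).

Lemma nat_dvdXnP e p : nat_dvdXn e p ->
  exists2 p' : {poly int}, p' \is a polyOver Num.nat & p = 'X^e * p'.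
Proof.
move=> pP; exists (drop_poly e p).
  by apply/polyOverP=> i; rewrite coef_drop_poly natrEint; case: (pP (i + e)%N).
apply/polyP=> i; rewrite coefXnM coef_drop_poly.
by case: ltnP => [lt_ie|le_ei]; [case: (pP i) => _ -> | rewrite subnK].
Qed.

Lemma nat_dvdXn0 e : nat_dvdXn e 0.
Proof. by move=> i; rewrite coef0. Qed.

Lemma nat_dvdXnD e p q : nat_dvdXn e p -> nat_dvdXn e q -> nat_dvdXn e (p + q).
Proof.
move=> pP qP i; case: (pP i) (qP i) => p_ge0 p0 [q_ge0 q0]; rewrite coefD.
by split=> [|lt_ie]; [exact: addr_ge0 | rewrite p0 // q0].
Qed.

Lemma nat_dvdXnW e f p : (e <= f)%N -> nat_dvdXn f p -> nat_dvdXn e p.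
Proof.
move=> le_ef pP i; case: (pP i) => p_ge0 p0; split=> // lt_ie.
exact: p0 (leq_trans lt_ie le_ef).
Qed.

Lemma nat_dvdXnM c e p : nat_dvdXn e p -> nat_dvdXn (c + e) ('X^c * p).
Proof.
move=> pP i; rewrite coefXnM; case: ltnP => // le_ci.
by case: (pP (i - c)%N) => p_ge0 p0; split=> // lt_i; rewrite p0 // ltn_subLR.
Qed.

(** * The sign-free recursion on pairs *)

Section PairPoset.

Variable h : nat.

(* [upchains l u m] and [rowchains l v m] are the coefficients of t^m in U(l,u) *)
(* and D(l,v); the empty chain is counted in row 0.                           *)
Fixpoint upchains (l u m : nat) {struct m} : {poly int} :=
  if m is m'.+1 then
    \sum_(i < l.+1) \sum_(i <= j < u.+1) 'X^(h - i - j) * upchains i j m'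
  else 1.

Definition rowchains (l v m : nat) : {poly int} :=
  if m is m'.+1 then \sum_(l <= j < v) 'X^(h - l - j) * upchains l j m'
  else (l == 0%N)%:R.

Lemma upchains0 u m : upchains 0 u m = rowchains 0 u.+1 m.
Proof. by case: m => //= m; rewrite big_ord1. Qed.

Lemma upchainsS l u m :
  upchains l.+1 u m = upchains l u m + rowchains l.+1 u.+1 m.
Proof. by case: m => [|m] /=; rewrite ?addr0 // big_ord_recr. Qed.

Lemma rowchains_diag l m : rowchains l l m = ((l == 0%N) && (m == 0%N))%:R.
Proof. by case: m => [|m] /=; rewrite ?andbT // big_geq // andbF. Qed.

Lemma rowchainsS l v m : (l <= v)%N ->
  rowchains l v.+1 m = rowchains l v m + 'X^(h - l - v) * tshift (upchains l v) m.
Proof. by case: m => [|m] lv /=; rewrite ?mulr0 ?addr0 // big_nat_recr. Qed.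

Definition facs (c : nat) : {poly {poly int}} :=
  \prod_(c <= a < h.+1) (1 - 'X^a *: 'X).

Lemma series_mul_facs c a m : (c <= h)%N ->
  series_mul (facs c) a m
  = series_mul (facs c.+1) (fun i => a i - 'X^c * tshift a i) m.
Proof.
move=> le_ch; rewrite /facs big_ltn // mulrC series_mulM.
by apply: eq_series_mul => i; rewrite series_mul_linear.
Qed.

(* N(l,u) and E(l,v) of the header. *)
Definition upnum (l u : nat) : nat -> {poly int} :=
  series_mul (facs (h - l - u)) (upchains l u).

Definition rownum (l v : nat) : nat -> {poly int} :=
  series_mul (facs (h.+1 - l - v)) (rowchains l v).

Lemma rownum_diag l k : rownum l l k = ((l == 0%N) && (k == 0%N))%:R.
Proof.
rewrite /rownum; case: l => [|l].
  by rewrite !subn0 /facs big_geq // series_mul1 rowchains_diag.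
by rewrite /series_mul big1 // => j _; rewrite rowchains_diag mulr0.
Qed.

Lemma upnum0 u k : (u <= h)%N -> upnum 0 u k = rownum 0 u k.
Proof.
move=> le_uh; rewrite /upnum /rownum !subn0 series_mul_facs ?leq_subr // subSn //.
by apply: eq_series_mul => m; rewrite upchains0 rowchainsS // subn0 addrK.
Qed.

Lemma upnumS l u k : (l < u)%N -> (l.+1 + u <= h)%N ->
  upnum l.+1 u k = upnum l u k + rownum l.+1 u k.
Proof.
move=> lt_lu le_h; rewrite /upnum /rownum series_mul_facs; last by lia.
have -> : (h - l - u = (h - l.+1 - u).+1)%N by lia.
rewrite -[X in _ = _ + X]mul1r -series_mulDM; apply: eq_series_mul => m.
by rewrite upchainsS rowchainsS // mul1r addrA addrK.
Qed.

(** Row 0 is totally ordered with one element of each rank from h+1-v to h, so its chain series is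
    the inverse of the product of its factors. *)
Lemma rownum0 v k : (v <= h.+1)%N -> rownum 0 v k = (k == 0%N)%:R.
Proof.
elim: v => [|v IH] le_vh; first exact: rownum_diag.
rewrite -IH ?(ltnW le_vh) // -(@upnum0 v) // /rownum /upnum !subn0 subSS.
by apply: eq_series_mul => m; rewrite upchains0.
Qed.

Lemma rownumS l v k : (l < v)%N -> (l.+1 + v <= h)%N ->
  rownum l.+1 v.+1 k
  = rownum l.+1 v k + 'X^(h - l.+1 - v) * tshift (upnum l v) k.
Proof.
move=> lt_lv le_h; rewrite /rownum /upnum -series_mul_tshift.
have -> : (h.+1 - l.+1 - v.+1 = h - l.+1 - v)%N by lia.
rewrite series_mul_facs; last by lia.
have -> : (h - l - v = (h - l.+1 - v).+1)%N by lia.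
rewrite -series_mulDM; apply: eq_series_mul => m.
rewrite rowchainsS // -addrA -mulrBr; congr (_ + _ * _).
(* The minus sign disappears here: U(l+1,v) - D(l+1,v+1) = U(l,v). *)
by case: m => [|m] /=; rewrite ?subr0 // upchainsS addrK.
Qed.

(** * Exponent bounds along the recursion *)

Lemma top_expS k : ((k + k).+2 <= h)%N ->
  (k.+1 * (h - k.+1 - 1) = k * (h - k - 1) + (h - (k + k).+2))%N.
Proof.
move=> le_h; have [d ->] : exists d, (h = (k + k).+2 + d)%N.
  by exists (h - (k + k).+2)%N; rewrite subnKC.
have -> : ((k + k).+2 + d - k.+1 - 1 = k + d)%N by lia.
have -> : ((k + k).+2 + d - k - 1 = k + d + 1)%N by lia.
rewrite addKn; lia.
Qed.

(** For a full row, [v = h.+1 - l], the lower exponent becomes k(k-1). The truncation in [k.-1] is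
    harmless, being multiplied by k. *)
Definition num_bounds (l v k : nat) (p : {poly int}) : Prop :=
  [/\ nat_dvdXn (k * (h.+1 - l - v + k.-1)) p, (l < k)%N -> p = 0
    & (size p <= (k * (h - k - 1)).+1)%N].

Lemma num_bounds_nat l v k (b : bool) : (b -> k = 0%N) -> num_bounds l v k b%:R.
Proof.
case: b => [->//|_]; last by split; rewrite ?size_poly0 //; exact: nat_dvdXn0.
by split; rewrite ?size_poly1 //; move=> i; rewrite coef1; case: i.
Qed.

(** Rows and up-sets feed each other, so both are bounded in one induction on l, with an inner
    induction on v. For up-sets only the leading term at k = l is tracked: no other one can reach
    the top exponent of a later row. *)
Lemma num_boundsP l :
     (forall v k, (l <= v)%N -> (l + v <= h.+1)%N ->
        num_bounds l v k (rownum l v k)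
        /\ ((l < v)%N -> (rownum l v k)`_(k * (h - k - 1)) = (k == l)%:R))
  /\ (forall u k, (l <= u)%N -> (l + u <= h)%N ->
        num_bounds l u k (upnum l u k)
        /\ ((l < u)%N -> (upnum l u l)`_(l * (h - l - 1)) = 1)).
Proof.
elim: l => [|l [_ IHup]].
  have bd v k : (v <= h.+1)%N -> num_bounds 0 v k (rownum 0 v k).
    by move=> le_v; rewrite rownum0 //; apply: (@num_bounds_nat 0 v) => /eqP.
  split=> [v|u] k _ le_h; split=> //.
  - exact: bd.
  - by rewrite rownum0 // => _; case: k => [|k]; rewrite ?coef1 // coef0.
  - by rewrite upnum0 //; apply: bd; apply: ltnW.
  - by rewrite upnum0 // rownum0 ?coef1 // ltnW.
have Hrow v k : (l.+1 <= v)%N -> (l.+1 + v <= h.+1)%N ->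
    num_bounds l.+1 v k (rownum l.+1 v k)
    /\ ((l.+1 < v)%N -> (rownum l.+1 v k)`_(k * (h - k - 1)) = (k == l.+1)%:R).
  elim: v => // v IH; rewrite leq_eqVlt => /orP[/eqP<- _|lt_lv le_h].
    split; last by rewrite ltnn.
    by rewrite rownum_diag; apply: num_bounds_nat.
  have le_2k j : (j <= l)%N -> ((j + j).+2 <= h)%N by lia.
  (* By [top_expS] the top exponent grows by h-2j-2 from t^j to t^(j+1). The shift fits since j <= l
     < v, and fills this room only at v = l+1, j = l. *)
  have le_c j : (j <= l)%N -> (h - l.+1 - v <= h - (j + j).+2)%N by lia.
  have lt_c j : (j <= l)%N -> ~~ ((v == l.+1) && (j == l)) ->
    (h - l.+1 - v < h - (j + j).+2)%N by lia.
  have {IH} [|[dv vn sz] tp] := IH lt_lv; first by lia.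
  have {}tp : (rownum l.+1 v k)`_(k * (h - k - 1))
      = ((l.+1 < v)%N && (k == l.+1))%:R.
    case: ltnP => [/tp //|le_vl]; have -> : v = l.+1 by lia.
    by rewrite rownum_diag coef0.
  rewrite rownumS //; last by lia.
  case: k => [|k] /= in dv vn sz tp *.
    by rewrite mulr0 addr0; split=> // _; rewrite tp andbF.
  have [||[dv' vn' sz'] tp'] := IHup v k; try lia.
  split=> [|_].
    split.
    - apply: nat_dvdXnD; first by apply: nat_dvdXnW dv; rewrite leq_mul2l; lia.
      (* The lower bound is reproduced exactly: with c = h-l-1-v, c + k(c+k+1) = (k+1)(c+k). *)
      apply: nat_dvdXnW (nat_dvdXnM (h - l.+1 - v) dv').
      case: k {dv vn sz tp dv' vn' sz' tp'} => [|k] /=; first by lia.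
      have -> : (h.+1 - l - v = (h - l.+1 - v).+2)%N by lia.
      by rewrite !subSS; lia.
    - by move=> lt_lk; rewrite vn // vn' // mulr0 addr0.
    - rewrite (leq_trans (size_polyD _ _)) // geq_max sz /=.
      have [le_kl|/vn'->] := leqP k l; last by rewrite mulr0 size_poly0.
      apply: leq_trans (size_polyMleq _ _) _; rewrite size_polyXn /=.
      by rewrite top_expS ?le_2k // -addSn addnC leq_add // le_c.
  rewrite coefD tp eqSS coefXnM.
  have [lt_lk|le_kl] := ltnP l k.
    by rewrite vn' // coef0 if_same (gtn_eqF lt_lk) andbF addr0.
  rewrite top_expS ?le_2k //.
  have [/andP[/eqP ev /eqP ek]|ne] := boolP ((v == l.+1) && (k == l)).
    (* The one step that reaches the top: the leading 1 of N(l,l+1) enters row l+1. *)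
    have -> : (h - l.+1 - v = h - (l + l).+2)%N by rewrite ev -subnDA addSn addnS.
    by rewrite ek addnK tp' // ev ltnn eqxx add0r ltnNge leq_addl.
  rewrite [X in _ + X](_ : _ = 0); last first.
    case: ifP => // _; apply: nth_default; apply: leq_trans sz' _.
    by rewrite -addnBA ?le_c // -addn1 leq_add2l subn_gt0 lt_c.
  rewrite addr0; move: ne; case: (k =P l) => [_|_ _]; last by rewrite andbF.
  by rewrite !andbT ltn_neqAle [l.+1 == v]eq_sym => ->; rewrite -ltnS lt_lv.
split=> // u k lt_lu le_h; rewrite !upnumS //.
have [[dv vn sz] tp] := Hrow u k lt_lu (leqW le_h).
have [||[dv' vn' sz'] _] := IHup u k; try lia.
split; first split.
- apply: nat_dvdXnD => //; apply: nat_dvdXnW dv'.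
  by rewrite leq_mul2l leq_add2r leq_sub2r ?leq_sub2l ?orbT.
- by move=> lt_lk; rewrite vn // vn' ?addr0 // ltnW.
- by rewrite (leq_trans (size_polyD _ _)) // geq_max sz' sz.
(* N(l,u) has no t^(l+1), so the leading 1 comes from the row. *)
move=> lt; rewrite coefD.
have [_ -> //] := Hrow u l.+1 lt_lu (leqW le_h).
have [||[_ -> //] _] := IHup u l.+1; try lia.
by rewrite eqxx coef0 add0r.
Qed.

End PairPoset.

(** * Positive roots as pairs *)

Section RootCoordinates.

Variable r : nat.
Hypothesis r_gt0 : (0 < r)%N.

Local Notation h := (2 * (r - 1))%N.

(* The root e_l - e_(2r-1-u) for 0-based indices, with e_r = 0 and             *)
(* e_(2r-j) = - e_j for j < r.                                                *)
Definition root_vec (l u : nat) : 'rV[int]_r :=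
  \row_(k < r) (((k : nat) == l)%:R - ((k : nat) == h.+1 - u)%N%:R
                + ((k : nat) == u.+1)%:R).

Lemma sum_ord_eq (k : 'I_r) a :
  \sum_(j < r | (j <= k)%N) ((j : nat) == a)%:R = (a <= k)%N%:R :> int.
Proof.
have [le_ak|lt_ka] := leqP a k.
  have lt_ar := leq_ltn_trans le_ak (ltn_ord k).
  rewrite (bigD1 (Ordinal lt_ar)) //= eqxx big1 ?addr0 // => j /andP[_ ne].
  by rewrite -[j == a :> nat]/(j == Ordinal lt_ar) (negbTE ne).
by rewrite big1 // => j le_jk; rewrite ltn_eqF // (leq_ltn_trans le_jk).
Qed.

Lemma simple_coords_root_vec l u (k : 'I_r) :
  simple_coords (root_vec l u) 0 k
  = (l <= k)%N%:R - (h.+1 - u <= k)%N%:R + (u < k)%N%:R.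
Proof.
rewrite simple_coordsE -!sum_ord_eq -sumrB -big_split.
by apply: eq_bigr => j _; rewrite mxE.
Qed.

Lemma height_root_vec l u : (l <= u)%N -> (l + u <= h)%N ->
  height (root_vec l u) = (h.+1 - l - u)%N%:Z.
Proof.
have cnt m a : \sum_(k < m) (a <= k)%N%:R = (m - a)%N%:Z :> int.
  elim: m => [|m IH]; first by rewrite big_ord0.
  by rewrite big_ord_recr /= IH; case: leqP; lia.
move=> le_lu le_h; rewrite /height.
under eq_bigr do rewrite simple_coords_root_vec.
rewrite big_split sumrB !cnt /=; lia.
Qed.

Lemma stdvecE (i k : 'I_r) : stdvec i 0 k = ((k : nat) == i)%:R.
Proof. by rewrite mxE eqxx. Qed.

Lemma root_vec_mem l u : (l <= u)%N -> (l + u <= h)%N ->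
  root_vec l u \in pos_roots r.
Proof.
move=> le_lu le_h; have lt_l : (l < r)%N by lia.
(* At most one of the indices u+1 and h+1-u is below r; neither is when u+1 = r, which gives the
   short root e_l. *)
rewrite !mem_cat; apply/or3P; case: (ltngtP u.+1 r) => [lt_ur|gt_ur|eq_ur].
- apply: Or33; apply/allpairsPdep.
  exists (Ordinal lt_l), (Ordinal lt_ur); rewrite !mem_enum; split=> //.
  apply/rowP=> k; rewrite [RHS]mxE !stdvecE mxE /=.
  have /ltn_eqF-> : (k < h.+1 - u)%N by have := ltn_ord k; lia.
  by rewrite subr0.
- have lt_j : (h.+1 - u < r)%N by lia.
  apply: Or31; apply/allpairsPdep.
  exists (Ordinal lt_l), (Ordinal lt_j); rewrite !mem_enum !inE; split=> //=.
    by lia.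
  apply/rowP=> k; rewrite [RHS]mxE [X in _ + X]mxE !stdvecE mxE /=.
  have /ltn_eqF-> : (k < u.+1)%N by have := ltn_ord k; lia.
  by rewrite addr0.
- apply: Or32; apply/mapP; exists (Ordinal lt_l); rewrite ?mem_enum //.
  apply/rowP=> k; rewrite stdvecE mxE /= eq_ur.
  have -> : (h.+1 - u = r)%N by lia.
  by rewrite (ltn_eqF (ltn_ord k)) subr0 addr0.
Qed.

Lemma root_vec_surj v : v \in pos_roots r ->
  exists l u, [/\ (l <= u)%N, (l + u <= h)%N & v = root_vec l u].
Proof.
rewrite !mem_cat => /or3P[/allpairsPdep|/mapP|/allpairsPdep].
- case=> i [j] [_]; rewrite mem_enum inE => lt_ij ->.
  have lt_jr := ltn_ord j.
  exists i, (h.+1 - j)%N; split; [lia | lia |].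
  apply/rowP=> k; rewrite mxE [X in _ + X]mxE !stdvecE mxE.
  have /ltn_eqF-> : (k < (h.+1 - j).+1)%N by have := ltn_ord k; lia.
  by rewrite addr0 subKn //; lia.
- case=> i _ ->; have lt_ir := ltn_ord i.
  exists i, r.-1; split; [lia | lia |].
  apply/rowP=> k; rewrite stdvecE mxE prednK //.
  have -> : (h.+1 - r.-1 = r)%N by lia.
  by rewrite (ltn_eqF (ltn_ord k)) subr0 addr0.
- case=> i [j] [_]; rewrite mem_enum inE => lt_ij ->.
  have lt_jr := ltn_ord j.
  exists i, j.-1; split; [lia | lia |].
  apply/rowP=> k; rewrite mxE !stdvecE mxE prednK ?(leq_ltn_trans _ lt_ij) //.
  have /ltn_eqF-> : (k < h.+1 - j.-1)%N by have := ltn_ord k; lia.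
  by rewrite subr0.
Qed.

Lemma root_vec_leP l u l' u' :
  (l <= u)%N -> (l + u <= h)%N -> (l' <= u')%N -> (l' + u' <= h)%N ->
  [forall i, 0 <= simple_coords (root_vec l' u' - root_vec l u) 0 i]
  = (l' <= l)%N && (u' <= u)%N.
Proof.
move=> le_lu le_h le_lu' le_h'.
have cE (i : 'I_r) : simple_coords (root_vec l' u' - root_vec l u) 0 i
    = simple_coords (root_vec l' u') 0 i - simple_coords (root_vec l u) 0 i.
  by rewrite /simple_coords mulmxBl !mxE.
apply/forallP/andP => [ge0|[le_l le_u] i]; last first.
  rewrite cE !simple_coords_root_vec subr_ge0; have := ltn_ord i.
  do 6 case: leqP => ?; lia.
have le_at k : (k < r)%N ->
    ((l <= k)%N%:R - (h.+1 - u <= k)%N%:R + (u < k)%N%:R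
     <= (l' <= k)%N%:R - (h.+1 - u' <= k)%N%:R + (u' < k)%N%:R :> int).
  move=> lt_kr; have := ge0 (Ordinal lt_kr).
  by rewrite cE !simple_coords_root_vec subr_ge0.
(* The smaller root has coefficient 1 at l, so the larger one is positive there. *)
have le_l : (l' <= l)%N.
  by have := le_at l; do 6 case: leqP => ?; lia.
split=> //; rewrite leqNgt; apply/negP => lt_u.
(* If u < u', some coefficient drops: from 1 to 0 where the larger root has already ended, or from 2
   to at most 1 at u+1. *)
have [le_u'r|lt_u'r] := leqP r u'.
  by have := le_at (maxn l (h.+1 - u')); do 6 case: leqP => ?; lia.
by have := le_at u.+1; do 6 case: leqP => ?; lia.
Qed.

(** * The poset isomorphism and the transfer of chain sums *)

Local Notation root_index :=
  {p : 'I_r * 'I_h.+1 | (p.1 <= p.2)%N && (p.1 + p.2 <= h)%N}.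

Implicit Types t : root_index.

Lemma root_index_mem t : root_vec (val t).1 (val t).2 \in pos_roots r.
Proof. by have /andP[le_lu le_h] := valP t; apply: root_vec_mem. Qed.

Definition root_of t : pos_root r := SeqSub (root_index_mem t).

Lemma root_of_le t t' : (root_of t <= root_of t')%O
  = ((val t').1 <= (val t).1)%N && ((val t').2 <= (val t).2)%N.
Proof.
have /andP[le_lu le_h] := valP t; have /andP[le_lu' le_h'] := valP t'.
by rewrite root_leE /root_le root_vec_leP.
Qed.

Lemma rk_root_of t : rk (root_of t) = (h - (val t).1 - (val t).2)%N.
Proof.
have /andP[le_lu le_h] := valP t.
by rewrite /rk height_root_vec //; lia.
Qed.

Lemma root_of_bij : bijective root_of.
Proof.
have root_of_inj : injective root_of.
  move=> t t' eq_t; have := root_of_le t' t; have := root_of_le t t'.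
  rewrite eq_t lexx => /esym/andP[le1 le2] /esym/andP[ge1 ge2].
  apply: val_inj; apply: injective_projections; apply: val_inj.
    by apply/eqP; rewrite eqn_leq ge1 le1.
  by apply/eqP; rewrite eqn_leq ge2 le2.
have root_of_surj y : exists t, root_of t == y.
  have [l [u [le_lu le_h ey]]] := root_vec_surj (mem_pos_root y).
  have lt_l : (l < r)%N by lia.
  have lt_u : (u < h.+1)%N by lia.
  have lu_valid : (Ordinal lt_l <= Ordinal lt_u)%N
    && (Ordinal lt_l + Ordinal lt_u <= h)%N by apply/andP.
  exists (exist _ (Ordinal lt_l, Ordinal lt_u) lu_valid).
  by rewrite -(inj_eq val_inj) ey.
have gK y : root_of (xchoose (root_of_surj y)) = y.
  by apply/eqP; apply: (xchooseP (root_of_surj y)).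
exists (fun y => xchoose (root_of_surj y)) => // t.
exact: root_of_inj.
Qed.

Lemma sum_pos_roots (G : pos_root r -> {poly int}) (Q : pred (pos_root r)) :
  \sum_(y | Q y) G y = \sum_(t : root_index | Q (root_of t)) G (root_of t).
Proof. by rewrite (reindex root_of) //; apply: onW_bij; apply: root_of_bij. Qed.

(** The bound on [b] makes l + u <= h automatic; [b] is constant for an up-set and h+1-i for the
    whole poset. *)
Lemma sum_root_index (F : nat -> nat -> {poly int}) m (b : nat -> nat) :
  (m <= r)%N -> (forall i, (i < m)%N -> (b i + i <= h.+1)%N) ->
  \sum_(t : root_index | ((val t).1 < m)%N && ((val t).2 < b (val t).1)%N)
    F (val t).1 (val t).2
  = \sum_(i < m) \sum_(i <= j < b i) F i j.
Proof.
move=> le_mr le_b.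
rewrite -(big_sub_cond _ (fun p : 'I_r * 'I_h.+1 => (p.1 < m)%N && (p.2 < b p.1)%N)
           (fun p => F p.1 p.2)) /=.
rewrite (big_ord_widen _ (fun i => \sum_(i <= j < b i) F i j) le_mr) /=.
rewrite [RHS](eq_bigr (fun i : 'I_r =>
  \sum_(j < h.+1 | (i <= j < b i)%N) F i j)); last first.
  move=> i lt_im; rewrite (@big_nat_widen _ _ _ i (b i) h.+1); last first.
    by have := le_b i lt_im; lia.
  by rewrite big_geq_mkord; apply: eq_bigl => j; rewrite andbC.
rewrite pair_big_dep /=; apply: eq_bigl => -[i j] /=.
rewrite unfold_in /=; case: (ltnP i m) => [lt_im|_]; last by rewrite andbF.
case: (ltnP j (b i)) => [lt_jb|_]; last by rewrite !andbF.
have -> : (i + j <= h)%N by have := le_b i lt_im; lia.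
by rewrite !andbT.
Qed.

Lemma path_sum t m :
  \sum_(s : m.-tuple (pos_root r) | path <=%O (root_of t) s) 'X^(\sum_(x <- s) rk x)
  = upchains h (val t).1 (val t).2 m :> {poly int}.
Proof.
elim: m => [|m IH] in t *.
  by rewrite (big_pred1 [tuple]) ?big_nil // => s; rewrite tuple0 /= eqxx.
rewrite (big_tuple_cons _ (path <=%O (root_of t))
  (fun s => 'X^(\sum_(x <- s) rk x))) /=.
transitivity (\sum_(y | (root_of t <= y)%O) 'X^(rk y) *
   \sum_(s : m.-tuple (pos_root r) | path <=%O y s)
     'X^(\sum_(x <- s) rk x) : {poly int}).
  rewrite [RHS]big_mkcond; apply: eq_bigr => y _; case: ifP => _ /=.
    by rewrite mulr_sumr; apply: eq_bigr => s _; rewrite big_cons exprD.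
  by rewrite big_pred0.
have /andP[le_lu le_h] := valP t.
rewrite sum_pos_roots.
rewrite -(@sum_root_index (fun i j => 'X^(h - i - j) * upchains h i j m)
  _ (fun=> (val t).2.+1)) //; last first.
  by move=> i lt_i; rewrite addSn ltnS (leq_trans _ le_h) // addnC leq_add2r -ltnS.
by apply: eq_big => [t'|t' _]; rewrite ?root_of_le // rk_root_of IH.
Qed.

Lemma qzeta_rk m :
  qzeta (@rk r) m = \sum_(l < r) rowchains h l (h.+1 - l) m.
Proof.
case: m => [|m] /=.
  rewrite /qzeta (big_pred1 [tuple]) => [|s]; last by rewrite tuple0 /= eqxx.
  rewrite big_nil (bigD1 (Ordinal r_gt0)) //= big1 ?addr0 // => l ne.
  by rewrite -[(l == 0 :> nat)%N]/(l == Ordinal r_gt0) (negbTE ne).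
rewrite /qzeta (big_tuple_cons _ (sorted <=%O) (fun s => 'X^(\sum_(x <- s) rk x))).
rewrite sum_pos_roots.
rewrite -(@sum_root_index (fun i j => 'X^(h - i - j) * upchains h i j m)
  _ (fun i => h.+1 - i)%N) //; last by move=> i lt_ir /=; lia.
apply: eq_big => [t|t _].
  by have /andP[_ le_h] := valP t; rewrite ltn_ord ltn_subRL ltnS le_h.
rewrite -path_sum mulr_sumr; apply: eq_bigr => s _.
by rewrite big_cons exprD rk_root_of.
Qed.

Lemma max_rank_rk : max_rank (@rk r) = h.
Proof.
have [g gK Kg] := root_of_bij.
apply/eqP; rewrite eqn_leq; apply/andP; split.
  by apply/bigmax_leqP => y _; rewrite -(Kg y) rk_root_of; lia.
have lu_valid : (Ordinal r_gt0 <= @ord0 h)%N && (Ordinal r_gt0 + @ord0 h <= h)%N.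
  by [].
rewrite /max_rank (bigD1 (root_of (exist _ (Ordinal r_gt0, ord0) lu_valid))) //=.
by rewrite rk_root_of !subn0 leq_maxl.
Qed.

(** A full row carries the factors of all ranks from 0 to h, which is the whole denominator. *)
Lemma qzeta_numerator_rk k :
  (qzeta_numerator (@rk r))`_k = \sum_(l < r) rownum h l (h.+1 - l) k.
Proof.
rewrite -(qzeta_numeratorP (@rk_lt r)) (eq_series_mul _ qzeta_rk).
have -> : qzeta_denom (@rk r) = facs h 0.
  by rewrite /qzeta_denom max_rank_rk /facs big_mkord.
rewrite {1}/series_mul; under eq_bigr do rewrite mulr_sumr.
by rewrite exchange_big; apply: eq_bigr => l _; rewrite /rownum subnn.
Qed.

End RootCoordinates.

Theorem corollary8p6 (r : nat) (hr : (1 <= r)%N) (k : nat)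
    (hk : (k <= r - 1)%N) :
  let n := (r - 1)%N in
  let h : {poly int} := (qzeta_numerator (@rk r))`_k in
  [/\ exists2 p : {poly int}, p \is a polyOver Num.nat
        & h = 'X^(k * (k - 1)) * p,
      size h = (k * (2 * n - k - 1)).+1
    & h`_(k * (2 * n - k - 1)) = 1].
Proof.
move=> n p.
have bd l : (l < r)%N -> num_bounds (2 * n) l ((2 * n).+1 - l) k
      (rownum (2 * n) l ((2 * n).+1 - l) k)
    /\ (rownum (2 * n) l ((2 * n).+1 - l) k)`_(k * (2 * n - k - 1)) = (k == l)%:R.
  move=> lt_lr; have [+ _] := num_boundsP (2 * n) l.
  by case/(_ ((2 * n).+1 - l)%N k) => [||bd ->]; rewrite /n; try lia; split.
have top : p`_(k * (2 * n - k - 1)) = 1.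
  rewrite /p qzeta_numerator_rk // coef_sum.
  (* The bound k <= n guarantees that the row l = k, the only one with a top term, occurs in the
     sum. *)
  have lt_kr : (k < r)%N by lia.
  rewrite (bigD1 (Ordinal lt_kr)) //= big1 => [|l ne].
    by case: (bd k lt_kr) => _ ->; rewrite eqxx addr0.
  case: (bd l (ltn_ord l)) => _ ->; rewrite eq_sym.
  by rewrite -[(l == k :> nat)%N]/(l == Ordinal lt_kr) (negbTE ne).
have size_le : (size p <= (k * (2 * n - k - 1)).+1)%N.
  rewrite /p qzeta_numerator_rk //; apply: (leq_trans (size_sum _ _ _)).
  by apply/bigmax_leqP => l _; case: (bd l (ltn_ord l)) => -[].
split=> //.
  apply: nat_dvdXnP; rewrite /p qzeta_numerator_rk // subn1.
  elim/big_ind: _ => [|q1 q2|l _]; [exact: nat_dvdXn0 | exact: nat_dvdXnD |].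
  by case: (bd l (ltn_ord l)) => -[+ _ _] _; rewrite subnn.
apply/eqP; rewrite eqn_leq size_le ltnNge; apply: contraT; rewrite negbK => le_top.
by move: top; rewrite nth_default.
Qed.
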